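(* Let $\Lambda$ be a set and let $\Gamma$ be a subshift of $\Lambda^\omega$. If $\Gamma$ is a subshift of bounded type, then $(\Gamma,\sigma)$ has the asymptotic shadowing property.
   Context: Let $\omega=\{0,1,2,\dots\}$. $\Lambda$ is an arbitrary (possibly infinite) set. $\Lambda^\omega$ is the set of infinite sequences $x=x_0x_1x_2\cdots$ over $\Lambda$, with the product topology where $\Lambda$ is discrete, metrized by $d(x,y)=\inf\{2^{-n}: x_i=y_i \text{ for all } i<n\}$; the shift map is $\sigma(x_0x_1x_2\cdots)=x_1x_2\cdots$. A subshift of $\Lambda^\omega$ is a closed set $\Gamma\subseteq\Lambda^\omega$ with $\sigma(\Gamma)=\Gamma$. A word is a finite sequence over $\Lambda$ of length at least $1$; it is allowed for $\Gamma$ if it occurs as a block of consecutive symbols (subword) of some $x\in\Gamma$, and forbidden otherwise. A basis for the forbidden words of $\Gamma$ is a set $\mathcal F$ of forbidden words such that every forbidden word contains some element of $\mathcal F$ as a subword. $\Gamma$ is a subshift of bounded type (SBT) if it has a basis for its forbidden words whose elements have uniformly bounded length. For a map $f:X\to X$ on a metric space, an asymptotic pseudo-orbit is a sequence $\langle x_i\rangle_{i\in\omega}$ in $X$ with $d(f(x_i),x_{i+1})\to0$ as $i\to\infty$. $(X,f)$ has the asymptotic shadowing property if for every asymptotic pseudo-orbit $\langle x_i\rangle$ there is $z\in X$ with $d(f^i(z),x_i)\to0$ as $i\to\infty$. *)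

(* Defs.v *)
From HB Require Import structures.
From mathcomp Require Import all_boot all_order all_algebra.
From mathcomp Require Import finmap.
From mathcomp Require Import all_classical all_reals all_analysis.

Set Implicit Arguments.
Unset Strict Implicit.
Unset Printing Implicit Defensive.

Import Order.TTheory GRing.Theory Num.Theory.
Import numFieldNormedType.Exports.

Local Open Scope classical_set_scope.
Local Open Scope ring_scope.

(* The alphabet is an arbitrary [Type]; [{classic _}] only supplies the
   equality and choice structures required by the topology library. *)
Definition omega_seq (Lambda : Type) : Type := nat -> Lambda.

HB.instance Definition _ (Lambda : Type) :=
  Uniform.copy (omega_seq Lambda)
    {ptws nat -> discrete_topology {classic Lambda}}.

Section SequenceMetric.
Context {R : realType} {Lambda : Type}.
Implicit Types x y z : omega_seq Lambda.

Definition agree (n : nat) x y : Prop := forall i, (i < n)%N -> x i = y i.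

Definition seq_dist x y : R := inf [set 2 ^- n | n in [set n | agree n x y]].

Lemma agreeW m n x y : (m <= n)%N -> agree n x y -> agree m x y.
Proof. by move=> mn xy i im; apply: xy; exact: leq_trans mn. Qed.

Lemma agree_sym n x y : agree n x y -> agree n y x.
Proof. by move=> xy i /xy. Qed.

Let exprV_lt m n : (2 ^- m < 2 ^- n :> R) = (n < m)%N.
Proof. by rewrite -!exprVn ltr_iXn2l// ?invr_gt0// invf_lt1// ltr1n. Qed.

Let has_inf_agree x y :
  has_inf [set (2 ^- n : R) | n in [set n | agree n x y]].
Proof.
split; first by exists (2 ^- 0), 0%N.
by exists 0 => _ [n _ <-]; rewrite invr_ge0 exprn_ge0.
Qed.

Lemma seq_dist_ge0 x y : 0 <= seq_dist x y.
Proof.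
apply: lb_le_inf; first exact: (has_inf_agree x y).1.
by move=> _ [n _ <-]; rewrite invr_ge0 exprn_ge0.
Qed.

Lemma seq_dist_ltP x y (e : R) :
  seq_dist x y < e <-> exists2 n, agree n x y & 2 ^- n < e.
Proof.
split; first by case/(inf_lt (has_inf_agree x y).1) => _ [n xy <-] ?; exists n.
move=> [n xy]; apply: le_lt_trans; apply: ge_inf; last by exists n.
exact: (has_inf_agree x y).2.
Qed.

Lemma seq_dist_agree n x y : seq_dist x y < 2 ^- n -> agree n x y.
Proof.
by case/seq_dist_ltP => m xy; rewrite exprV_lt => /ltnW nm; exact: agreeW xy.
Qed.

Let exists_exprV (e : R) : 0 < e -> exists n, 2 ^- n < e.
Proof.
move=> e0; have [n _ ne] := near_infty_natSinv_expn_lt (PosNum e0).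
by exists n; have := ne n (leqnn n); rewrite /= div1r.
Qed.

Definition seq_ball x (e : R) : set (omega_seq Lambda) :=
  [set y | seq_dist x y < e].

Lemma seq_ball_center x (e : R) : 0 < e -> seq_ball x e x.
Proof. by case/exists_exprV => n ?; apply/seq_dist_ltP; exists n. Qed.

Lemma seq_ball_sym x y (e : R) : seq_ball x e y -> seq_ball y e x.
Proof.
by case/seq_dist_ltP => n xy ?; apply/seq_dist_ltP; exists n => //;
  exact: agree_sym.
Qed.

Lemma seq_ball_triangle x y z (e1 e2 : R) :
  seq_ball x e1 y -> seq_ball y e2 z -> seq_ball x (e1 + e2) z.
Proof.
rewrite /seq_ball /= => xy yz.
have e1_gt0 := le_lt_trans (seq_dist_ge0 x y) xy.
have e2_gt0 := le_lt_trans (seq_dist_ge0 y z) yz.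
case/seq_dist_ltP: xy => m xy me; case/seq_dist_ltP: yz => n yz ne.
apply/seq_dist_ltP; exists (minn m n).
  by move=> i; rewrite leq_min => /andP[/xy -> /yz].
have [mn|nm] := leqP m n; first by rewrite ltr_wpDr// ltW.
by rewrite ltr_wpDl// ltW.
Qed.

Lemma entourage_agreeP (E : set (omega_seq Lambda * omega_seq Lambda)) :
  entourage E <-> exists n, [set p | agree n p.1 p.2] `<=` E.
Proof.
split.
  case=> _ [F _ <-] FE.
  exists (\max_(p <- F) ((sval p).1 : nat).+1)%N => -[x y] /= xy.
  apply: FE => p /= pF; have := svalP p => /asboolP [D entD]; apply.
  suff xyp : x (sval p).1 = y (sval p).1.
    by apply: entD; exists (x (sval p).1) => //; congr pair; exact: xyp.
  by apply: xy; exact: leq_bigmax_seq.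
case=> n nE; apply: filterS nE _; elim: n => [|n IHn].
  by apply: filterS filterT => p _ i.
have: entourage [set p : omega_seq Lambda * omega_seq Lambda | p.1 n = p.2 n].
  pose T (i : nat) : uniformType :=
    initial_topology
      (@proj nat (fun=> discrete_topology {classic Lambda}) i).
  pose A := [set p : omega_seq Lambda * omega_seq Lambda | p.1 n = p.2 n].
  have entA : @entourage (T n) A.
    exists [set p : discrete_topology {classic Lambda} *
                    discrete_topology {classic Lambda} | p.1 = p.2] => //.
    by rewrite /= uniform_discrete => _ [x _ <-].
  have memA : `[< @entourage (T n) A >] by apply/asboolP.
  exists A => //.
  have -> : A = (sval (exist (fun p : {classic nat} * _ =>
    is_true `[< @entourage (T p.1) p.2 >]) (n, A) memA)).2 by [].
  exact: (@finI_from1 _ _ setT (fun p => (sval p).2)).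
apply: filterS2 IHn => -[x y] /= xy xyn i; rewrite ltnS leq_eqVlt.
by case/predU1P => [->//|/xy].
Qed.

Lemma seq_entourageE :
  @entourage (omega_seq Lambda) = entourage_ seq_ball.
Proof.
apply/seteqP; split => E.
  case/entourage_agreeP => n nE; exists (2 ^- n : R).
    by rewrite /= invr_gt0 exprn_gt0.
  by move=> p /seq_dist_agree; exact: nE.
case=> e /exists_exprV[n ne] eE; apply/entourage_agreeP; exists n => p np.
by apply: eE; apply/seq_dist_ltP; exists n.
Qed.

Lemma seq_dist_positivity x y : seq_dist x y = 0 -> x = y.
Proof.
move=> xy0; apply/funext => i; apply: (@seq_dist_agree i.+1) => //.
by rewrite xy0 invr_gt0 exprn_gt0.
Qed.

End SequenceMetric.

(* The topology above is the product topology; [seq_entourageE] shows that the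
   distance metrizes it, so that [mdist] and [closed] are compatible. *)
HB.instance Definition _ (R : realType) (Lambda : Type) :=
  @Uniform_isPseudoMetric.Build R (omega_seq Lambda) seq_ball
    seq_ball_center seq_ball_sym seq_ball_triangle seq_entourageE.

HB.instance Definition _ (R : realType) (Lambda : Type) :=
  @PseudoMetric_isMetric.Build R (omega_seq Lambda) seq_dist
    seq_dist_ge0 seq_dist_positivity (fun _ _ => erefl).

Definition shift_map {Lambda : Type} (x : omega_seq Lambda) : omega_seq Lambda :=
  fun n => x n.+1.

Definition subshift {Lambda : Type} (Gamma : set (omega_seq Lambda)) : Prop :=
  closed Gamma /\ shift_map @` Gamma = Gamma.

Section Words.
Context {Lambda : Type}.
Implicit Types (Gamma : set (omega_seq Lambda)) (v w : seq {classic Lambda}).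

Definition word w : Prop := w <> [::].

Definition occurs_in w (x : omega_seq Lambda) : Prop :=
  exists i, w = mkseq (fun k => x (i + k)%N) (size w).

Definition allowed Gamma w : Prop :=
  word w /\ exists2 x, Gamma x & occurs_in w x.

Definition forbidden Gamma w : Prop := word w /\ ~ allowed Gamma w.

Definition forbidden_basis Gamma (F : set (seq {classic Lambda})) : Prop :=
  F `<=` forbidden Gamma /\
  forall w, forbidden Gamma w -> exists2 v, F v & infix v w.

Definition bounded_type Gamma : Prop :=
  exists F, forbidden_basis Gamma F /\
    exists N : nat, forall w, F w -> (size w <= N)%N.

End Words.

Section Shadowing.
Context {R : realType} {M : metricType R}.

(* The dynamical system is the restriction of [f] to [X], a subspace of [M]
   that [f] is meant to map into itself. *)
Definition asymptotic_pseudo_orbit (X : set M) (f : M -> M) (x : nat -> M) :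
    Prop :=
  (forall i, X (x i)) /\
  (fun i => mdist (f (x i)) (x i.+1) : R) @ \oo --> (0 : R).

Definition asymptotic_shadowing (X : set M) (f : M -> M) : Prop :=
  forall x : nat -> M, asymptotic_pseudo_orbit X f x ->
    exists2 z, X z & (fun i => mdist (iter i f z) (x i) : R) @ \oo --> (0 : R).

End Shadowing.

(* Main.v *)
Require Import Defs.
From mathcomp Require Import all_boot all_order all_algebra.
From mathcomp Require Import all_classical all_reals all_analysis.

(** The shadowing point reads off the initial symbols [x_i(0)] of the
    pseudo-orbit. If [sigma x_i] and [x_{i+1}] agree on [n] symbols for all
    large [i], then [x_i(k) = x_{i+k}(0)] for [k <= n] and all large [i], so every
    short enough block far along the diagonal sequence is a block of some
    [x_i], hence allowed. When the forbidden words have a basis of bounded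
    length, a tail of the diagonal thus lies in [Gamma]; pulling it back
    through the surjective shift gives the shadowing point. *)

Set Implicit Arguments.
Unset Strict Implicit.
Unset Printing Implicit Defensive.

Import Order.TTheory GRing.Theory Num.Theory.
Import numFieldNormedType.Exports.

Local Open Scope classical_set_scope.
Local Open Scope ring_scope.

Lemma cvg_mdist0_agreeP (R : realType) (Lambda : Type)
    (u v : nat -> omega_seq Lambda) :
  (fun i => mdist (u i) (v i) : R) @ \oo --> (0 : R) <->
  forall n, \forall i \near \oo, agree n (u i) (v i).
Proof.
split=> [uv n|uv].
  have e0 : 0 < 2 ^- n :> R by rewrite invr_gt0 exprn_gt0.
  have /cvgr0Pnorm_lt/(_ _ e0) := uv; apply: filterS => i /= uvi.
  by apply: (@seq_dist_agree R); apply: le_lt_trans uvi; exact: ler_norm.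
apply/cvgr0Pnorm_lt => e e0.
have [n _ ne] := (seq_dist_ltP _ _ _).1 (seq_ball_center (u 0%N) e0).
apply: filterS (uv n) => i uvi; rewrite ger0_norm; last exact: seq_dist_ge0.
by apply/seq_dist_ltP; exists n.
Qed.

Lemma closed_agreeP (Lambda : Type) (Gamma : set (omega_seq Lambda))
    (y : omega_seq Lambda) :
  closed Gamma -> (forall n, exists2 x, Gamma x & agree n y x) -> Gamma y.
Proof.
move=> clG apx; apply: clG => U /nbhsP[E /entourage_agreeP[n nE] EU].
have [x Gx yx] := apx n; exists x; split=> //.
by apply: EU; apply/xsectionP; exact: nE.
Qed.

Lemma iter_shift_mapE (Lambda : Type) i (x : omega_seq Lambda) :
  iter i shift_map x = fun k => x (i + k)%N.
Proof.
by elim: i => //= i ->; apply/funext => k; rewrite /shift_map addSnnS.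
Qed.

Section Subshift.
Variables (Lambda : Type) (Gamma : set (omega_seq Lambda)).
Hypothesis subG : subshift Gamma.

Lemma subshift_iter i x : Gamma x -> Gamma (iter i shift_map x).
Proof.
by move=> Gx; elim: i => //= i IHi; rewrite -subG.2; exists (iter i shift_map x).
Qed.

Lemma subshift_iter_surj i x :
  Gamma x -> exists2 z, Gamma z & iter i shift_map z = x.
Proof.
elim: i x => [|i IHi] x; first by exists x.
by rewrite -{1}subG.2 => -[x' /IHi[z Gz <-] <-]; exists z.
Qed.

Lemma subshift_allowed (y : omega_seq Lambda) :
  (forall n, allowed Gamma (mkseq y n.+1 : seq {classic Lambda})) -> Gamma y.
Proof.
move=> ally; apply: closed_agreeP subG.1 _ => n.
have [_ [x Gx [i]]] := ally n; rewrite size_mkseq => yx.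
exists (iter i shift_map x); first exact: subshift_iter.
move=> k kn; have kn1 : (k < n.+1)%N by exact: ltnW.
rewrite iter_shift_mapE.
have := congr1 (fun s => nth (y 0%N) s k) yx.
by rewrite /= !(nth_mkseq _ _ kn1).
Qed.

Lemma bounded_type_local : bounded_type Gamma ->
  exists N, forall y : omega_seq Lambda,
    (forall i, exists2 x, Gamma x & agree N x (iter i shift_map y)) -> Gamma y.
Proof.
move=> [F [[Fforb Fbasis] [N FN]]]; exists N => y yloc.
apply: subshift_allowed => n; apply: contrapT => nall.
have [|v Fv /infixP[s [t yv]]] := Fbasis (mkseq y n.+1); first by split.
have [v0 +] := Fforb v Fv; apply; split=> //.
have [x Gx xy] := yloc (size s); exists x => //; exists 0%N.
apply: (@eq_from_nth _ (y 0%N)); first by rewrite size_mkseq.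
move=> k kv; rewrite nth_mkseq// add0n xy; last exact: leq_trans kv (FN _ Fv).
rewrite iter_shift_mapE.
have := congr1 (fun w => nth (y 0%N) w (size s + k)%N) yv.
rewrite /= nth_cat ltnNge leq_addr/= addKn nth_cat kv => <-.
rewrite nth_mkseq// -(size_mkseq y n.+1) yv !size_cat ltn_add2l.
exact: ltn_addr.
Qed.

End Subshift.

Lemma agree_diagonal (Lambda : Type) (x : nat -> omega_seq Lambda) n K :
  (forall i, (K <= i)%N -> agree n (shift_map (x i)) (x i.+1)) ->
  forall i, (K <= i)%N -> agree n (x i) (fun k => x (i + k)%N 0%N).
Proof.
move=> xK i Ki k; elim: k i Ki => [|k IHk] i Ki kn; first by rewrite addn0.
have kn' := ltnW kn.
by rewrite -addSnnS -IHk ?(leqW Ki)//; exact: xK.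
Qed.

Theorem corollary13 (R : realType) (Lambda : Type)
    (Gamma : set (omega_seq Lambda)) (hGamma : subshift Gamma)
    (hbounded : bounded_type Gamma) :
  @asymptotic_shadowing R (omega_seq Lambda) Gamma shift_map.
Proof.
move=> x [Gx /cvg_mdist0_agreeP xS].
have [N GN] := bounded_type_local hGamma hbounded.
have [K _ xK] := xS N.
have Gtail : Gamma (fun k => x (K + k)%N 0%N).
  apply: GN => i; exists (x (K + i)%N) => //; rewrite iter_shift_mapE.
  by move=> k kN; rewrite (agree_diagonal xK)// ?leq_addr// addnA.
have [z Gz zE] := subshift_iter_surj hGamma K Gtail.
exists z => //; apply/cvg_mdist0_agreeP => n.
have [L _ xL] := xS n.
exists (maxn K L) => // i; rewrite /= geq_max => /andP[Ki Li].
rewrite -{1}(subnK Ki) iterD zE iter_shift_mapE => k kn.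
by rewrite (agree_diagonal xL Li kn) addnA subnKC.
Qed.
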